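(* Let $\mathcal{J}$ be a set of $n$ jobs with ending times upper-bounded by $N$ (unit rewards). For any $\varepsilon>0$, there exists a local computation algorithm for $(1+\varepsilon)$-approximate unweighted interval scheduling of $\mathcal{J}$ on $M$ machines using $O\left(\frac{M\log N}{\varepsilon}\right)$ probes per query.
   Context: Each job $j$ is an interval $[s_j,s_j+l_j]$ with $s_j\ge0$, $l_j\ge1$, $s_j+l_j\le N$. A feasible schedule on $M$ machines assigns a subset of jobs to machines so that jobs on the same machine pairwise do not overlap; the goal is to maximize the number of scheduled jobs; $(1+\varepsilon)$-approximate means at least $1/(1+\varepsilon)$ times the optimum. Local computation algorithm: it has probe access to a successor oracle which, given a time $x$ and a set $S$ of jobs to ignore, returns the job with earliest ending time among the jobs not in $S$ that start after $x$. On a query job $I$ it must answer whether $I$ is scheduled (and on which machine), with all answers consistent with a single $(1+\varepsilon)$-approximate feasible schedule; the complexity is the number of probes per query. *)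

(* Defs.v *)
From HB Require Import structures.
From mathcomp Require Import all_boot all_order all_algebra finmap.
From mathcomp Require Import reals.

Set Implicit Arguments.
Unset Strict Implicit.
Unset Printing Implicit Defensive.

Import Order.TTheory GRing.Theory Num.Theory.
Local Open Scope ring_scope.
Local Open Scope fset_scope.

(* The label lets an instance contain several jobs with the same interval. *)
Record job (R : realType) := Job { label : nat; start : R; len : R }.

Section JobChoice.
Variable R : realType.
Definition job_tuple (j : job R) : nat * R * R := (label j, start j, len j).
Definition tuple_job (p : nat * R * R) : job R := Job p.1.1 p.1.2 p.2.
Lemma job_tupleK : cancel job_tuple tuple_job.
Proof. by case. Qed.
HB.instance Definition _ := Choice.copy (job R) (can_type job_tupleK).
End JobChoice.

Definition finish (R : realType) (j : job R) : R := start j + len j.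

Definition valid_jobs (R : realType) (N : R) (J : {fset job R}) : Prop :=
  forall j, j \in J -> [/\ 0 <= start j, 1 <= len j & finish j <= N].

(* The flag [touch] fixes the treatment of endpoints, uniformly in "starts
   after" and in "overlap": if it is true, a job may start at the very moment
   another one ends (x <= s), if it is false, the closed intervals
   [s, s + l] of the jobs on one machine have to be disjoint (x < s). *)
Definition starts_after (R : realType) (touch : bool) (x : R) (j : job R) :
  bool := x < start j ?<= if touch.

Definition overlap (R : realType) (touch : bool) (i j : job R) : bool :=
  ~~ starts_after touch (finish i) j && ~~ starts_after touch (finish j) i.

(* [None] stands for "not scheduled". *)
Definition schedule (R : realType) (J : {fset job R}) (M : nat) :=
  {ffun J -> option 'I_M}.

Definition feasible (R : realType) (touch : bool) (J : {fset job R}) (M : nat)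
    (sigma : schedule J M) : bool :=
  [forall i : J, forall j : J,
     [&& i != j, isSome (sigma i) & sigma i == sigma j] ==>
     ~~ overlap touch (val i) (val j)].

Definition num_scheduled (R : realType) (J : {fset job R}) (M : nat)
    (sigma : schedule J M) : nat :=
  #|[pred i : J | isSome (sigma i)]|.

Definition optimum (R : realType) (touch : bool) (J : {fset job R}) (M : nat) :
  nat := (\max_(sigma : schedule J M | feasible touch sigma)
            num_scheduled sigma)%N.

Definition approximate (R : realType) (touch : bool) (eps : R)
    (J : {fset job R}) (M : nat) (sigma : schedule J M) : Prop :=
  (1 + eps)^-1 * (optimum touch J M)%:R <= (num_scheduled sigma)%:R.

(* A probe is a time together with a finite set of jobs to ignore. *)
Definition oracle (R : realType) := R -> {fset job R} -> option (job R).

(* Ties between ending times may be broken in any way. *)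
Definition successor_oracle (R : realType) (touch : bool) (J : {fset job R})
    (O : oracle R) : Prop :=
  forall (x : R) (S : {fset job R}),
    let candidate k := [&& k \in J, k \notin S & starts_after touch x k] in
    match O x S with
    | Some j => candidate j /\ forall k, candidate k -> finish j <= finish k
    | None => forall k, ~~ candidate k
    end.

(* Adaptive computations whose only access to the instance is by probes. *)
Inductive probing (R : realType) (A : Type) : Type :=
| Answer of A
| Probe of R & {fset job R} & (option (job R) -> probing R A).

Fixpoint answer (R : realType) (A : Type) (O : oracle R) (p : probing R A) :
    A :=
  match p with
  | Answer a => a
  | Probe x X k => answer O (k (O x X))
  end.

Fixpoint num_probes (R : realType) (A : Type) (O : oracle R)
    (p : probing R A) : nat :=
  match p with
  | Answer _ => 0%N
  | Probe x X k => (num_probes O (k (O x X))).+1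
  end.

(* The computation depends on the queried job only: no state is kept between
   queries, and the set of jobs is not an input. *)
Definition lca (R : realType) (M : nat) := job R -> probing R (option 'I_M).

Definition consistent (R : realType) (M : nat) (alg : lca R M) (O : oracle R)
    (J : {fset job R}) (sigma : schedule J M) : Prop :=
  forall i : J, answer O (alg (val i)) = sigma i.

(* Main.v *)
(** On a window of time, the best-fit greedy algorithm (repeatedly accept the
    job of earliest finishing time that some machine can take, on the fitting
    machine that became available last) is optimal, and one probe, at the
    earliest time at which a machine is available and ignoring the accepted
    jobs, yields the next accepted job.

    The time line is bisected. With [K] of the order of [M / eps], a region is
    cut at the midpoint of its core only if the greedy algorithm finds at least
    [K] jobs on both sides, which takes at most [2 K] probes to test; otherwise
    the poorer side is set aside as part of the head or the tail of the region.
    After about [log N] halvings the core is too short to contain a job, so the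
    region has fewer than [2 (K + M)] jobs and is solved exactly. A cut loses
    at most the [M] jobs that cross it, and as every region produced by a cut
    contains [K] jobs, [K] times the number of cuts is at most the number of
    scheduled jobs. *)

Require Import Defs.
From mathcomp Require Import all_boot all_order all_algebra finmap.
From mathcomp Require Import reals exp.
From mathcomp Require Import zify ring lra.

Set Implicit Arguments.
Unset Strict Implicit.
Unset Printing Implicit Defensive.

Import Order.TTheory GRing.Theory Num.Theory.
Local Open Scope fset_scope.
Local Open Scope ring_scope.

(** * The best-fit greedy algorithm, directly and by probes *)

Section Algorithm.
Variables (R : realType) (touch : bool) (m : nat).
Implicit Types (A B : 'I_m.+1 -> R) (S : {fset job R}) (a b c x : R).
Implicit Types (l : seq (job R * 'I_m.+1)) (I j : job R).

Definition free a x : bool := a < x ?<= if touch.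

Definition update A (q : 'I_m.+1) x := fun i => if i == q then x else A i.

Definition earliest A : 'I_m.+1 := [arg min_(i < ord0) A i]%O.

(** The default [earliest A] is free for [j] as soon as any machine is, which makes the arg max
    meaningful for the jobs returned by the oracle. *)
Definition best_fit A j : 'I_m.+1 :=
  [arg max_(i > earliest A | free (A i) (start j)) A i]%O.

(* [A i] is the time from which machine [i] is available and [S] the set of
   jobs accepted so far; jobs that end after [b] are out of the window. *)
Fixpoint greedy (O : oracle R) (k : nat) A S b : seq (job R * 'I_m.+1) :=
  if k is k'.+1 then
    if O (A (earliest A)) S is Some j then
      if finish j <= b then
        let q := best_fit A j in
        (j, q) :: greedy O k' (update A q (finish j)) (j |` S) b
      else [::]
    else [::]
  else [::].

(** Continuation-passing style lets later probes depend on the greedy list. *)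
Fixpoint greedy_probing T (k : nat) A S b
    (cont : seq (job R * 'I_m.+1) -> probing R T) : probing R T :=
  if k is k'.+1 then
    Probe (A (earliest A)) S (fun r =>
      if r is Some j then
        if finish j <= b then
          let q := best_fit A j in
          greedy_probing k' (update A q (finish j)) (j |` S) b
            (fun l => cont ((j, q) :: l))
        else cont [::]
      else cont [::])
  else cont [::].

Lemma answer_greedy_probing T (O : oracle R) k A S b
    (cont : seq (job R * 'I_m.+1) -> probing R T) :
  answer O (greedy_probing k A S b cont) = answer O (cont (greedy O k A S b)).
Proof.
elim: k A S cont => [|k IHk] A S cont //=.
by case: (O _ S) => [j|] //; case: ifP => // _; rewrite IHk.
Qed.

Lemma num_probes_greedy_probing T (O : oracle R) k A S b
    (cont : seq (job R * 'I_m.+1) -> probing R T) :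
  (num_probes O (greedy_probing k A S b cont)
     <= k + num_probes O (cont (greedy O k A S b)))%N.
Proof.
elim: k A S cont => [|k IHk] A S cont //=.
rewrite addSn ltnS; case: (O _ S) => [j|]; last exact: leq_addl.
by case: ifP => _; [exact: IHk | exact: leq_addl].
Qed.

Lemma size_greedy_mono (O : oracle R) k k' A S b : (k <= k')%N ->
  (size (greedy O k A S b) <= size (greedy O k' A S b))%N.
Proof.
elim: k k' A S => [|k IHk] [|k'] A S //= lek.
by case: (O _ S) => [j|] //; case: ifP => //= _; rewrite ltnS IHk.
Qed.

Lemma free_le a a' x : a <= a' -> free a' x -> free a x.
Proof.
by rewrite /free; case: touch => /=; [exact: le_trans | exact: le_lt_trans].
Qed.

Lemma free_mono a x x' : x <= x' -> free a x -> free a x'.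
Proof.
rewrite /free; case: touch => /= lex h; first exact: le_trans h lex.
exact: lt_le_trans h lex.
Qed.

Lemma freeW a x : free a x -> a <= x.
Proof. exact: lteifW. Qed.

Lemma not_free_le a s x : free a s -> ~~ free a x -> x <= s.
Proof.
by move=> fs; apply: contraNT; rewrite -ltNge => /ltW les; apply: free_mono fs.
Qed.

Lemma earliestP A i : A (earliest A) <= A i.
Proof. by rewrite /earliest; case: arg_minP => // q _; apply. Qed.

Lemma best_fitP A j : free (A (earliest A)) (start j) ->
  free (A (best_fit A j)) (start j)
  /\ forall i, free (A i) (start j) -> A i <= A (best_fit A j).
Proof.
by move=> h; rewrite /best_fit; case: arg_maxP => // q fq maxq; split.
Qed.

(** * Comparing machine availabilities by counting busy machines *)

Definition busy A x : nat := (\sum_i (~~ free (A i) x : nat))%N.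

Lemma busy_update A q t x :
  (busy (update A q t) x + ~~ free (A q) x = busy A x + ~~ free t x)%N.
Proof.
rewrite /busy (bigD1 q) //= [in RHS](bigD1 q) //= /update eqxx.
rewrite (eq_bigr (fun i => (~~ free (A i) x : nat))); last first.
  by move=> i /negPf ->.
by rewrite addnAC [RHS]addnAC [X in (X + _)%N]addnC.
Qed.

Lemma busy_le A x s : (forall i, free (A i) s -> free (A i) x) ->
  (busy A x <= busy A s)%N.
Proof.
move=> h; apply: leq_sum => i _.
by case: (boolP (free (A i) s)) => [/h -> //|_]; case: free.
Qed.

Lemma busy_lt A q x s : free (A q) s -> ~~ free (A q) x ->
  (busy A s < busy A x)%N.
Proof.
move=> fs fx; rewrite /busy (bigD1 q) //= fs [X in (_ < X)%N](bigD1 q) //= fx.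
rewrite add0n add1n ltnS; apply: leq_sum => i _.
case: (boolP (free (A i) x)) => [h|_]; last by case: free.
by rewrite (free_mono (not_free_le fs fx) h).
Qed.

Lemma busy_eq0 A t x : (forall i, A i <= t) -> free t x -> busy A x = 0%N.
Proof. by move=> h ft; rewrite /busy big1 // => i _; rewrite (free_le (h i) ft). Qed.

Lemma busy_all A x : (forall i, ~~ free (A i) x) -> busy A x = m.+1.
Proof.
by move=> h; rewrite /busy (eq_bigr (fun=> 1%N)) ?sum1_card ?card_ord // => i _; rewrite h.
Qed.

Lemma busy_max A x : (busy A x <= m.+1)%N.
Proof.
rewrite -[X in (_ <= X)%N]card_ord -sum1_card; apply: leq_sum => i _.
by case: free.
Qed.

(** Counting at every time compares the availability times as multisets, whatever the names of the
    machines. [D] is the number of jobs by which the greedy side [A] is ahead. *)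
Definition dominated A B (D : nat) : Prop :=
  forall x, (busy A x <= busy B x + D)%N.

Lemma dominated_accept A B D q t :
  dominated A B D -> dominated (update A q t) B D.+1.
Proof. by move=> dom x; have := busy_update A q t x; have := dom x; lia. Qed.

(** At time [s] all machines of [A] are busy but [p] is free in [B], so [D] is positive and one unit
    of it pays for the job that only [B] takes. If [p] is already busy in [B] at [x], then [x <= s]
    and [B] has strictly more busy machines at [x] than at [s]. *)
Lemma dominated_reject A B D p s t :
  dominated A B D -> (forall i, ~~ free (A i) s) -> free (B p) s -> s <= t ->
  (forall i, A i <= t) ->
  exists2 D', D = D'.+1 & dominated A (update B p t) D'.
Proof.
move=> dom rej fB le_st leA.
have busyA := busy_all rej; have := dom s; rewrite busyA => doms.
have ltB: (busy B s < m.+1)%N.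
  have := busy_update B p (A p) s; rewrite fB rej.
  by have := busy_max (update B p (A p)) s; lia.
case: D dom doms => [|D] dom doms; first by lia.
exists D => // x; have [ft|nft] := boolP (free t x).
  by rewrite (busy_eq0 leA ft).
have := busy_update B p t x; rewrite nft.
have [fBx|nfBx] /= := boolP (free (B p) x); first by have := dom x; lia.
by have := busy_lt fB nfBx; have := busy_max A x; lia.
Qed.

(** The only critical times [x] are those at which [q] is free in [A] but [p] is busy in [B]. There
    best fit helps: every machine of [A] free at [s] is free at [x], so [busy A x <= busy A s],
    while [B] has strictly more busy machines at [x] than at [s]. *)
Lemma dominated_both A B D p q s t :
  dominated A B D -> free (A q) s ->
  (forall i, free (A i) s -> A i <= A q) -> free (B p) s -> s <= t ->
  (forall i, A i <= t) ->
  dominated (update A q t) (update B p t) D.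
Proof.
move=> dom fA maxA fB le_st leA x; have [ft|nft] := boolP (free t x).
  rewrite (@busy_eq0 _ t) // => i; rewrite /update; case: eqP => // _.
have := busy_update B p t x; have := busy_update A q t x; rewrite nft.
have := dom x.
have [fBx|nfBx] := boolP (free (B p) x);
  have [fAx|nfAx] /= := boolP (free (A q) x); try by lia.
have := busy_lt fB nfBx; have := dom s.
have: (busy A x <= busy A s)%N.
  by apply: busy_le => i /maxA leAi; apply: free_le leAi fAx.
lia.
Qed.

(** * Bisection of the time line, globally and for one query *)

Definition lookup l I : option 'I_m.+1 := ohead [seq p.2 | p <- l & p.1 == I].

(* A region [a, b] is a core [c0, c1] between a head [a, c0] and a tail
   [c1, b] that both have fewer than [K] greedy jobs. The core is halved; the
   region is cut at the midpoint only if both sides have at least [K] greedy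
   jobs, otherwise a side with fewer jobs becomes the new head or tail. *)
Fixpoint solve (O : oracle R) (K L n : nat) a c0 c1 b :
    seq (job R * 'I_m.+1) :=
  if n is n'.+1 then
    let c := (c0 + c1) / 2 in
    if (size (greedy O K (fun=> a) fset0 c) < K)%N then solve O K L n' a c c1 b
    else if (size (greedy O K (fun=> c) fset0 b) < K)%N then
      solve O K L n' a c0 c b
    else solve O K L n' a c0 c c ++ solve O K L n' c c c1 b
  else greedy O L (fun=> a) fset0 b.

(** At a cut only the side containing [I] is explored, so the cost is per level and not per region;
    a job on neither side crosses the cut and is dropped. *)
Fixpoint solve_probing (K L n : nat) a c0 c1 b I :
    probing R (option 'I_m.+1) :=
  if n is n'.+1 then
    let c := (c0 + c1) / 2 in
    greedy_probing K (fun=> a) fset0 c (fun l1 =>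
      if (size l1 < K)%N then solve_probing K L n' a c c1 b I
      else greedy_probing K (fun=> c) fset0 b (fun l2 =>
        if (size l2 < K)%N then solve_probing K L n' a c0 c b I
        else if finish I <= c then solve_probing K L n' a c0 c c I
        else if starts_after touch c I then solve_probing K L n' c c c1 b I
        else Answer _ None))
  else greedy_probing L (fun=> a) fset0 b (fun l => Answer _ (lookup l I)).

Lemma num_probes_solve_probing O K L n a c0 c1 b I :
  (num_probes O (solve_probing K L n a c0 c1 b I) <= n * (K + K) + L)%N.
Proof.
elim: n a c0 c1 b => [|n IHn] a c0 c1 b /=.
  by apply: leq_trans (num_probes_greedy_probing _ _ _ _ _ _) _; rewrite addn0.
apply: leq_trans (num_probes_greedy_probing _ _ _ _ _ _) _ => /=.
rewrite mulSn -!addnA leq_add2l; case: ifP => _.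
  by apply: leq_trans (IHn _ _ _ _) _; rewrite leq_addl.
apply: leq_trans (num_probes_greedy_probing _ _ _ _ _ _) _ => /=.
by rewrite leq_add2l; repeat case: ifP => _ //.
Qed.

Lemma lookup_mem l I q : lookup l I = Some q -> (I, q) \in l.
Proof.
rewrite /lookup; elim: l => //= -[j r] l IHl /=; case: eqP => [<- [<-]|_ /IHl].
  exact: mem_head.
by rewrite inE orbC => ->.
Qed.

Lemma isSome_lookup l I : isSome (lookup l I) = (I \in map fst l).
Proof.
rewrite /lookup; elim: l => //= -[j r] l IHl /=.
by rewrite inE eq_sym; case: eqP.
Qed.

Lemma lookup_cat l1 l2 I :
  lookup (l1 ++ l2) I = if I \in map fst l1 then lookup l1 I else lookup l2 I.
Proof.
rewrite -isSome_lookup /lookup filter_cat map_cat.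
by case: (map _ (filter _ l1)).
Qed.

Lemma lookup_notin l I : I \notin map fst l -> lookup l I = None.
Proof. by rewrite -isSome_lookup; case: lookup. Qed.

End Algorithm.

(** * Greedy schedules, windows and cuts *)

Section Analysis.
Variables (R : realType) (touch : bool) (m : nat) (N : R).
Variables (J : {fset job R}) (O : oracle R).
Hypotheses (validJ : valid_jobs N J) (succO : successor_oracle touch J O).
Implicit Types (A B : 'I_m.+1 -> R) (S : {fset job R}) (a b c x : R).
Implicit Types (l : seq (job R * 'I_m.+1)) (I j : job R).

Definition window a b j : bool := starts_after touch a j && (finish j <= b).

Definition schedules l : Prop :=
  [/\ {in l, forall p, p.1 \in J}, uniq (map fst l)
    & {in l &, forall p q, p.1 != q.1 -> p.2 = q.2 ->
        ~~ overlap touch p.1 q.1}].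

Lemma start_lt_finish j : j \in J -> start j < finish j.
Proof. by move=> /validJ[_ len1 _]; rewrite /finish; lra. Qed.

Lemma oracle_some A S j : O (A (earliest A)) S = Some j ->
  [/\ j \in J, j \notin S, free touch (A (earliest A)) (start j)
    & forall k, k \in J -> k \notin S ->
        free touch (A (earliest A)) (start k) -> finish j <= finish k].
Proof.
move=> Oj; have := succO (A (earliest A)) S; rewrite Oj => -[/and3P[Jj Sj fj] minj].
by split=> // k Jk Sk fk; apply: minj; rewrite Jk Sk.
Qed.

Lemma oracle_none A S k : O (A (earliest A)) S = None ->
  k \in J -> k \notin S -> ~~ free touch (A (earliest A)) (start k).
Proof.
move=> ON Jk Sk; have := succO (A (earliest A)) S; rewrite ON => /(_ k).
by rewrite Jk Sk.
Qed.

Lemma exists_earliest_finish l : l != [::] ->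
  exists2 p, p \in l & {in l, forall q, finish p.1 <= finish q.1}.
Proof.
elim: l => // p l IHl _; have [->|/IHl[q ql minq]] := eqVneq l [::].
  by exists p; rewrite ?mem_head // => q; rewrite inE => /eqP ->.
have [leqp|ltpq] := leP (finish q.1) (finish p.1).
  by exists q => [|r]; rewrite inE ?ql ?orbT // => /predU1P[-> //|/minq].
exists p => [|r]; rewrite inE ?eqxx // => /predU1P[-> //|/minq].
by apply: le_trans (ltW ltpq).
Qed.

Lemma schedules_rem l p : schedules l -> schedules (rem p l).
Proof.
move=> [lJ lu ln]; split.
- by move=> q /mem_rem /lJ.
- by apply: subseq_uniq lu; apply: map_subseq; exact: rem_subseq.
- by move=> q r /mem_rem ql /mem_rem rl; apply: ln.
Qed.

Lemma schedules_filter (P : pred (job R * 'I_m.+1)) l :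
  schedules l -> schedules (filter P l).
Proof.
move=> [lJ lu ln]; split.
- by move=> q; rewrite mem_filter => /andP[_ /lJ].
- by apply: subseq_uniq lu; apply: map_subseq; exact: filter_subseq.
- by move=> q r; rewrite !mem_filter => /andP[_ ql] /andP[_ rl]; apply: ln.
Qed.

Lemma schedules_uniq l : schedules l -> uniq l.
Proof. by case=> _ /map_uniq. Qed.

Lemma schedules_inj l : schedules l ->
  {in l &, forall p q, p.1 = q.1 -> p = q}.
Proof.
move=> [_ lu _] p q pl ql e.
have i1: (index p l < size l)%N by rewrite index_mem.
have i2: (index q l < size l)%N by rewrite index_mem.
have := @nth_uniq _ p.1 (map fst l) (index p l) (index q l).
rewrite !size_map !(nth_map p) // !nth_index // e eqxx => /(_ i1 i2 lu)/esym/eqP ei.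
by rewrite -(nth_index p pl) ei nth_index.
Qed.

Lemma no_overlap_free p q : p \in J -> q \in J -> ~~ overlap touch p q ->
  finish p <= finish q -> free touch (finish p) (start q).
Proof.
rewrite /overlap negb_and !negbK => Jp Jq /orP[//|] /freeW lepq lepq'.
by have := start_lt_finish Jp; have := start_lt_finish Jq; lra.
Qed.

Lemma available_rem l B p : schedules l -> p \in l ->
  {in l, forall q, finish p.1 <= finish q.1} ->
  {in l, forall q, free touch (B q.2) (start q.1)} ->
  {in rem p l, forall q,
     free touch (update B p.2 (finish p.1) q.2) (start q.1)}.
Proof.
move=> sl pl minp fB q; rewrite mem_rem_uniq ?(schedules_uniq sl) // inE.
move=> /andP[neq ql]; rewrite /update; case: eqP => [e|_]; last exact: fB.
have [lJ _ ln] := sl; apply: no_overlap_free; rewrite ?lJ ?minp //.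
apply: ln => //; apply: contra neq => /eqP e1; apply/eqP.
exact: (schedules_inj sl).
Qed.

(* The exchange argument: [l] is an arbitrary continuation of a schedule whose
   machines are available at the times [B], and [D] is the lead of the greedy
   schedule, which is processed in parallel in the order of finishing times. *)
Lemma greedy_optimal_from n k A B S b (D : nat) l :
  (k + size l <= n)%N ->
  schedules l ->
  {in l, forall p, [/\ p.1 \notin S, finish p.1 <= b,
                      free touch (B p.2) (start p.1)
                    & forall i, A i <= finish p.1]} ->
  dominated touch A B D ->
  (size (greedy touch O k A S b) < k)%N ->
  (size l <= size (greedy touch O k A S b) + D)%N.
Proof.
(* Each step consumes a greedy job, a job of [l], or both, hence the induction on a bound for
   [k + size l]. *)
elim: n k A B S D l => [|n IHn] [|k] A B S D l //.
rewrite addSn ltnS => le_n sl hl dom.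
have [lJ lu ln] := sl.
have [-> //|l_neq0] := eqVneq l [::].
have [p pl minp] := exists_earliest_finish l_neq0.
have Jp := lJ _ pl; have [Sp pb fBp leA] := hl _ pl.
have lt_p := start_lt_finish Jp.
(* This case, in which only [l] takes its next job, arises when the oracle returns nothing, a job
   ending after [b], or a job ending after [p]: by minimality of the answer, [p] then fits on no
   greedy machine. *)
have reject : ~~ free touch (A (earliest A)) (start p.1) ->
    (size (greedy touch O k.+1 A S b) < k.+1)%N ->
    (size l <= size (greedy touch O k.+1 A S b) + D)%N.
  move=> nf ltk.
  have nfA i : ~~ free touch (A i) (start p.1).
    by apply: contra nf; apply: free_le; exact: earliestP.
  have [D' -> dom'] := dominated_reject dom nfA fBp (ltW lt_p) leA.
  have szl: size l = (size (rem p l)).+1.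
    by rewrite size_rem // prednK //; case: (l) l_neq0.
  rewrite szl addnS ltnS.
  apply: (IHn k.+1 A (update B p.2 (finish p.1)) S D') => //.
  - by rewrite addSnnS -szl.
  - exact: schedules_rem.
  - move=> q qr; have [Sq qb fBq leAq] := hl _ (mem_rem qr); split=> //.
    by apply: (available_rem sl pl minp _ qr) => r /hl[].
move: reject => /=.
case Oj: (O (A (earliest A)) S) => [j|]; last first.
  by apply; exact: oracle_none Oj Jp Sp.
have [Jj Sj fj minj] := oracle_some Oj.
have [jb|jb] := ifP; last first.
  apply; apply/negP => /(minj _ Jp Sp) lejp.
  by rewrite (le_trans lejp pb) in jb.
have [lejp|ltpj] := leP (finish j) (finish p.1); last first.
  by apply; apply/negP => /(minj _ Jp Sp); rewrite leNgt ltpj.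
move=> _ /=; rewrite !ltnS addSn => ltk.
have [fjq maxq] := best_fitP fj; set q := best_fit _ _ _ in ltk fjq maxq *.
(* If [j] is not in [l], the lead grows by one; otherwise both sides take [j], possibly on different
   machines. *)
have [/mapP[r rl jr]|jl] := boolP (j \in map fst l); last first.
  rewrite -addnS.
  apply: (IHn k (update A q (finish j)) B (j |` S) D.+1) => //.
  - move=> r rl; have [Sr rb fBr leAr] := hl _ rl; split=> //.
    + rewrite in_fset1U negb_or Sr andbT.
      by apply: contra jl => /eqP <-; apply/mapP; exists r.
    + by move=> i; rewrite /update; case: eqP => // _; apply: le_trans (minp _ rl).
  - exact: dominated_accept.
have [Sr rb fBr leAr] := hl _ rl.
have szl: size l = (size (rem r l)).+1.
  by rewrite size_rem // prednK //; case: (l) l_neq0.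
have minr : {in l, forall p', finish r.1 <= finish p'.1}.
  by move=> p' /minp; rewrite -jr; apply: le_trans.
rewrite szl ltnS.
apply: (IHn k (update A q (finish j)) (update B r.2 (finish j)) (j |` S) D) => //.
- by apply: leq_trans le_n; rewrite szl addnS.
- exact: schedules_rem.
- move=> p' p'r; have p'l := mem_rem p'r.
  have [Sp' p'b fBp' leAp'] := hl _ p'l; split=> //.
  + rewrite in_fset1U negb_or Sp' andbT jr; apply/eqP.
    move=> /(schedules_inj sl p'l rl) e; move: p'r.
    by rewrite e mem_rem_uniq ?(schedules_uniq sl) // inE eqxx.
  + by rewrite jr; apply: (available_rem sl rl minr _ p'r) => r' /hl[].
  + by move=> i; rewrite /update; case: eqP => // _; rewrite jr minr.
- apply: (dominated_both (s := start j)) => //; first by rewrite jr.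
    by rewrite ltW ?start_lt_finish.
  by rewrite jr.
Qed.

Definition window_greedy (k : nat) a b : seq (job R * 'I_m.+1) :=
  greedy touch O k (fun=> a) fset0 b.

(** Fewer than [k] jobs means that the greedy run stopped for lack of jobs and not because [k] ran
    out. Both sides start with all machines available at [a], so the lead is 0. *)
Lemma greedy_optimal k a b l : schedules l ->
  (size (window_greedy k a b) < k)%N ->
  (count (window a b \o fst) l <= size (window_greedy k a b))%N.
Proof.
move=> sl ltk; rewrite -size_filter -[X in (_ <= X)%N]addn0.
apply: (greedy_optimal_from (n := k + size (filter (window a b \o fst) l))
          (B := fun=> a)) => //.
- exact: schedules_filter.
- move=> p; rewrite mem_filter /= => /andP[/andP[ap pb] pl].
  split=> // _; apply: le_trans (freeW ap) (ltW (start_lt_finish _)).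
  by have [lJ _ _] := sl; exact: lJ.
- by move=> x; rewrite addn0.
Qed.

Lemma greedy_schedules_from k A S b :
  let l := greedy touch O k A S b in
  schedules l /\
  {in l, forall p, [/\ p.1 \notin S, finish p.1 <= b
                     & free touch (A p.2) (start p.1)]}.
Proof.
elim: k A S => [|k IHk] A S /=; first by split=> //; split.
case Oj: (O (A (earliest A)) S) => [j|]; last by split=> //; split.
have [Jj Sj fj _] := oracle_some Oj.
have [jb|_] := ifP; last by split=> //; split.
have [fjq _] := best_fitP fj; set q := best_fit _ _ _ in fjq *.
have [[lJ lu ln] hl] := IHk (update A q (finish j)) (j |` S).
set l := greedy _ _ _ _ _ _ in lJ lu ln hl *.
have ltj := start_lt_finish Jj.
have hj p : p \in l -> p.2 = q -> free touch (finish j) (start p.1).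
  by move=> /hl[_ _ +] e; rewrite /update e eqxx.
split; first split.
- by move=> p /predU1P[->|/lJ].
- rewrite /= lu andbT; apply/mapP => -[p /hl[+ _ _] e].
  by rewrite in_fset1U -e eqxx.
- move=> p r /predU1P[->|pl] /predU1P[->|rl] /=; last exact: ln.
  + by rewrite eqxx.
  + by move=> _ e; rewrite /overlap /starts_after -/(free _ _ _) hj.
  + by move=> _ e; rewrite /overlap [X in _ && ~~ X]hj // andbF.
- move=> p /predU1P[-> //|/hl[Sp pb fp]]; split=> //.
    by move: Sp; rewrite in_fset1U negb_or => /andP[].
  move: fp; rewrite /update; case: eqP => // -> /freeW; rewrite -/q.
  move=> le1; apply: free_mono fjq; lra.
Qed.

Lemma window_greedy_schedules k a b : schedules (window_greedy k a b).
Proof. by case: (greedy_schedules_from k (fun=> a) fset0 b). Qed.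

Lemma window_greedy_window k a b :
  {in window_greedy k a b, forall p, window a b p.1}.
Proof.
move=> p pl; have [_ /(_ _ pl)[_ pb fp]] :=
  greedy_schedules_from k (fun=> a) fset0 b.
by rewrite /window pb andbT.
Qed.

(** Jobs crossing [c] overlap pairwise, so they occupy distinct machines and there are at most
    [m.+1] of them. *)
Lemma count_window_cut a b c l : schedules l ->
  (count (window a b \o fst) l
   <= count (window a c \o fst) l + count (window c b \o fst) l + m.+1)%N.
Proof.
move=> sl; have [lJ _ ln] := sl.
pose crossing := [pred p : job R * 'I_m.+1 |
  ~~ starts_after touch c p.1 && (c < finish p.1)].
have le_cross : (count crossing l <= m.+1)%N.
  rewrite -size_filter -(size_map snd) -[X in (_ <= X)%N]card_ord.
  rewrite -(card_uniqP _) ?max_card //.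
  rewrite map_inj_in_uniq ?filter_uniq ?(schedules_uniq sl) //.
  move=> p q; rewrite !mem_filter /= => /andP[/andP[sp fp] pl].
  move=> /andP[/andP[sq fq] ql] e; apply/eqP; apply/negPn/negP => neq.
  have /ln : p.1 != q.1.
    by apply: contra neq => /eqP/(schedules_inj sl pl ql) ->.
  move=> /(_ pl ql e); rewrite /overlap negb_and !negbK => /orP[] h.
    by move/negP: sq; apply; apply: free_le h; exact: ltW.
  by move/negP: sp; apply; apply: free_le h; exact: ltW.
apply: leq_trans (leq_add (leqnn _) le_cross).
rewrite -!sum1_count !(big_mkcond (_ \o _)) (big_mkcond crossing) /=.
rewrite -!big_split /=; apply: leq_sum => p _.
rewrite /window; have [fp|fp] := leP (finish p.1) c;
  case: (starts_after touch a p.1); case: (starts_after touch c p.1) => //=.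
all: by case: (finish p.1 <= b).
Qed.

Lemma count_short_window a b l : schedules l -> b - a < 1 ->
  count (window a b \o fst) l = 0%N.
Proof.
move=> [lJ _ _] ltba; apply/eqP; rewrite -leqn0 leqNgt -has_count.
apply/hasPn => p /lJ /validJ [_ len1 _]; rewrite /= negb_and.
case: (boolP (starts_after _ _ _)) => //= /freeW lea.
by rewrite -ltNge /finish; lra.
Qed.

Lemma size_window_greedy_short k a : size (window_greedy k a a) = 0%N.
Proof.
rewrite -(@count_short_window a a (window_greedy k a a));
  [|exact: window_greedy_schedules|lra].
by apply/esym/eqP; rewrite -all_count; apply/allP => p /window_greedy_window.
Qed.

Lemma schedules_cat a b c l1 l2 :
  schedules l1 -> {in l1, forall p, window a c p.1} ->
  schedules l2 -> {in l2, forall p, window c b p.1} ->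
  schedules (l1 ++ l2).
Proof.
move=> [J1 u1 n1] w1 [J2 u2 n2] w2.
have before p q : p \in l1 -> q \in l2 -> free touch (finish p.1) (start q.1).
  by move=> /w1/andP[_ lep] /w2/andP[fq _]; apply: free_le lep fq.
split.
- by move=> p; rewrite mem_cat => /orP[/J1|/J2].
- rewrite map_cat cat_uniq u1 u2 andbT /=; apply/hasPn => _ /mapP[q q2 ->].
  apply/mapP => -[p p1 e]; have /freeW := before _ _ p1 q2.
  by rewrite e leNgt start_lt_finish // J1.
- move=> p q; rewrite !mem_cat => /orP[p1|p2] /orP[q1|q2] neq e.
  + exact: n1.
  + by rewrite /overlap [starts_after _ _ _]before.
  + by rewrite /overlap [starts_after _ _ p.1]before // andbF.
  + exact: n2.
Qed.

(** * Invariant and accounting of the bisection *)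

Variable K : nat.
Hypothesis K_gt0 : (0 < K)%N.
Let L := (2 * (K + m.+1))%N.

(** Cutting at [c0] and [c1] leaves at most [K - 1] jobs in the head, as many in the tail, none in
    the core and at most [2 * m.+1] crossing jobs. The run of length [L] is thus exhaustive. *)
Lemma size_window_greedy_leaf a c0 c1 b : c1 - c0 < 1 ->
  (size (window_greedy K a c0) < K)%N -> (size (window_greedy K c1 b) < K)%N ->
  (size (window_greedy L a b) < L)%N.
Proof.
move=> short head tail; set l := window_greedy L a b.
have sl : schedules l := window_greedy_schedules L a b.
have -> : size l = count (window a b \o fst) l.
  by apply/esym/eqP; rewrite -all_count; apply/allP => p /window_greedy_window.
have := count_window_cut a b c0 sl; have := count_window_cut c0 b c1 sl.
have := count_short_window sl short.
have := greedy_optimal sl head; have := greedy_optimal sl tail.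
rewrite /L; lia.
Qed.

(** The second clause provides a spare [K], with which a region pays for the cut that created it. *)
Definition near_optimal a b l : Prop :=
  exists cuts : nat,
    [/\ (K * cuts <= size l)%N,
        (K <= size (window_greedy K a b))%N -> (K * cuts.+1 <= size l)%N
      & forall l', schedules l' ->
          (count (window a b \o fst) l' <= size l + m.+1 * cuts)%N].

Lemma solveP n a c0 c1 b :
  a <= c0 -> c0 <= c1 -> c1 <= b -> c1 - c0 < 2 ^+ n ->
  (size (window_greedy K a c0) < K)%N -> (size (window_greedy K c1 b) < K)%N ->
  let l := solve touch m O K L n a c0 c1 b in
  [/\ schedules l, {in l, forall p, window a b p.1},
      forall I, window a b I ->
        answer O (solve_probing touch m K L n a c0 c1 b I) = lookup l I
    & near_optimal a b l].
Proof.
elim: n a c0 c1 b => [|n IHn] a c0 c1 b le_ac0 le_c le_c1b short head tail /=.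
  split.
  - exact: window_greedy_schedules.
  - exact: window_greedy_window.
  - by move=> I _; rewrite answer_greedy_probing.
  (* A leaf has no cuts; its spare [K] comes from the run of length [L] being at least as long as
     that of length [K]. *)
  - exists 0%N; rewrite !muln0; split=> // [|l' sl'].
      rewrite muln1 => /leq_trans; apply; apply: size_greedy_mono.
      by rewrite /L; lia.
    rewrite addn0; apply: greedy_optimal => //.
    exact: size_window_greedy_leaf short head tail.
set c := (c0 + c1) / 2.
have le_c0c : c0 <= c by rewrite /c; lra.
have le_cc1 : c <= c1 by rewrite /c; lra.
have shortl : c - c0 < 2 ^+ n by move: short; rewrite exprS /c; lra.
have shortr : c1 - c < 2 ^+ n by move: short; rewrite exprS /c; lra.
rewrite -!/(window_greedy _ _ _).
have [left_small|left_big] := ltnP (size (window_greedy K a c)) K.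
  have [sl wl al nl] :=
    IHn a c c1 b (le_trans le_ac0 le_c0c) le_cc1 le_c1b shortr left_small tail.
  by split=> // I wI; rewrite answer_greedy_probing left_small al.
have [right_small|right_big] := ltnP (size (window_greedy K c b)) K.
  have [sl wl al nl] :=
    IHn a c0 c b le_ac0 le_c0c (le_trans le_cc1 le_c1b) shortl head right_small.
  split=> // I wI; rewrite answer_greedy_probing ltnNge left_big /=.
  by rewrite answer_greedy_probing right_small al.
(* After a cut, the left region has the empty tail [[c, c]] and the right one the empty head
   [[c, c]]. *)
have empty : (size (window_greedy K c c) < K)%N by rewrite size_window_greedy_short.
have [s1 w1 a1 [cuts1 [_ ge1 opt1]]] :=
  IHn a c0 c c le_ac0 le_c0c (lexx _) shortl head empty.
have [s2 w2 a2 [cuts2 [_ ge2 opt2]]] :=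
  IHn c c c1 b (lexx _) le_cc1 le_c1b shortr empty tail.
set l1 := solve _ _ _ _ _ _ a _ _ _ in s1 w1 a1 ge1 opt1 *.
set l2 := solve _ _ _ _ _ _ _ _ _ b in s2 w2 a2 ge2 opt2 *.
split.
- exact: schedules_cat s1 w1 s2 w2.
- move=> p; rewrite mem_cat /window => /orP[/w1|/w2] /andP[fp lep].
    by rewrite fp (le_trans lep) // (le_trans le_cc1).
  rewrite lep andbT; apply: free_le fp; exact: le_trans le_c0c.
- move=> I /andP[fI Ib]; rewrite answer_greedy_probing ltnNge left_big /=.
  rewrite answer_greedy_probing ltnNge right_big /= lookup_cat.
  have notin2 : ~~ starts_after touch c I -> lookup l2 I = None.
    move=> nf; apply: lookup_notin; apply: contra nf => /mapP[p /w2 wp ->].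
    by case/andP: wp.
  have [Ic|cI] := leP (finish I) c.
    (* A job ending by [c] that is missing from [l1] is not in [l2] either, since jobs of [l2] start
       no earlier than [c] and have positive length. *)
    rewrite a1 /window ?fI ?Ic //; case: ifP => // /negbT I1.
    rewrite (lookup_notin I1) lookup_notin //; apply/mapP => -[p p2 e].
    have /andP[/freeW] := w2 _ p2; rewrite -e => lecs _.
    have [+ _ _] := s2; move=> /(_ _ p2) /start_lt_finish; rewrite -e => lts.
    by move: Ic; rewrite leNgt (le_lt_trans lecs lts).
  have /negPf -> : I \notin map fst l1.
    apply/mapP => -[p /w1 /andP[_ lep] e].
    by move: cI; rewrite e ltNge lep.
  case: (boolP (starts_after touch c I)) => [fcI|/notin2 -> //].
  by rewrite a2 // /window fcI.
(* Both sides contain [K] greedy jobs, so both spare blocks are available: one pays for this cut,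
   the other is the spare of the whole region. *)
- exists (cuts1 + cuts2).+1.
  have := ge1 left_big; have := ge2 right_big; rewrite size_cat => le2 le1.
  split=> [|_|l' sl']; [lia|lia|].
  have := opt1 _ sl'; have := opt2 _ sl'; have := count_window_cut a b c sl'.
  lia.
Qed.

End Analysis.

(** * From lists of assigned jobs to schedules and back *)

Section Schedules.
Variables (R : realType) (touch : bool) (m : nat) (J : {fset job R}).

Definition schedule_of_seq (l : seq (job R * 'I_m.+1)) : schedule J m.+1 :=
  [ffun i => lookup l (val i)].

(** Only scheduled jobs are enumerated, so [odflt] always returns the assigned machine. *)
Definition seq_of_schedule (sigma : schedule J m.+1) :
    seq (job R * 'I_m.+1) :=
  [seq (val i, odflt ord0 (sigma i)) | i <- enum [pred i | isSome (sigma i)]].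

Lemma feasible_schedule_of_seq l :
  schedules touch J l -> feasible touch (schedule_of_seq l).
Proof.
move=> [_ _ ln]; apply/forallP => i; apply/forallP => j; apply/implyP.
rewrite !ffunE => /and3P[neq + /eqP e]; rewrite e.
case ej: (lookup l (val j)) => [q|] // _; rewrite ej in e.
exact: ln (lookup_mem e) (lookup_mem ej) _ _.
Qed.

Lemma size_le_num_scheduled l :
  schedules touch J l -> (size l <= num_scheduled (schedule_of_seq l))%N.
Proof.
move=> [lJ lu _]; rewrite -(size_map fst) /num_scheduled cardE -(size_map val).
apply: uniq_leq_size => // j jl.
have [p pl ej] := mapP jl; have Jj : j \in J by rewrite ej lJ.
by apply/mapP; exists [` Jj] => //; rewrite mem_enum !inE ffunE isSome_lookup.
Qed.

Lemma size_seq_of_schedule sigma :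
  size (seq_of_schedule sigma) = num_scheduled sigma.
Proof. by rewrite size_map -cardE. Qed.

Lemma schedules_seq_of_schedule sigma :
  feasible touch sigma -> schedules touch J (seq_of_schedule sigma).
Proof.
move=> /forallP feas; split.
- by move=> _ /mapP[i _ ->]; exact: valP.
- by rewrite -map_comp map_inj_uniq ?enum_uniq // => i j /val_inj.
- move=> _ _ /mapP[i + ->] /mapP[j + ->]; rewrite !mem_enum !inE /=.
  have /forallP/(_ j)/implyP := feas i.
  case: (sigma i) => // q; case: (sigma j) => //= r h _ _ neq e.
  by apply: h; rewrite e eqxx !andbT.
Qed.

End Schedules.

(** * Choice of parameters and numerical bounds *)

Section Bounds.
Variables (R : realType) (eps N : R) (M : nat).

Definition block_size : nat := (M * (Num.truncn eps^-1).+1)%N.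

(** [N + 1] is the length of the initial core [[-1, N]]. *)
Definition num_levels : nat := (Num.truncn (ln (N + 1) / ln 2)).+1.

Lemma ln2_gt0 : 0 < ln 2 :> R.
Proof. by apply: ln_gt0; lra. Qed.

Lemma num_levels_gt : 2 <= N -> N + 1 < 2 ^+ num_levels.
Proof.
move=> N2; have N1 : 0 < N + 1 by lra.
rewrite -ltr_ln ?posrE ?exprn_gt0 // lnXn // -[_ *+ num_levels]mulr_natl -ltr_pdivrMr ?ln2_gt0 //.
have /truncn_itv/andP[] // : 0 <= ln (N + 1) / ln 2.
by rewrite divr_ge0 ?(ltW ln2_gt0) // ln_ge0 //; lra.
Qed.

(** From [N + 1 <= N ^+ 2] the logarithm at most doubles, and the successor costs at most one more
    [ln N / ln 2]. *)
Lemma num_levels_le : 2 <= N -> num_levels%:R <= 3 * (ln N / ln 2).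
Proof.
move=> N2; have l2 := ln2_gt0.
have lnN : 1 <= ln N / ln 2.
  by rewrite ler_pdivlMr // mul1r ler_ln ?posrE //; lra.
have lnN1 : ln (N + 1) / ln 2 <= 2 * (ln N / ln 2).
  rewrite mulrA ler_pM2r ?invr_gt0 // mulr_natl -lnXn; last by lra.
  by rewrite ler_ln ?posrE ?exprn_gt0 //; [nra | lra | lra].
have /truncn_itv/andP[le_tr _] : 0 <= ln (N + 1) / ln 2.
  by rewrite divr_ge0 ?(ltW l2) // ln_ge0 //; lra.
by rewrite /num_levels -natr1; lra.
Qed.

(** As [eps * block_size] is at least [M], the loss [M * cuts] is at most [eps * found]. *)
Lemma approximation_ratio (opt found cuts : nat) : 0 < eps ->
  (opt <= found + M * cuts)%N -> (block_size * cuts <= found)%N ->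
  (1 + eps)^-1 * opt%:R <= found%:R :> R.
Proof.
move=> eps0 le_opt le_cuts; rewrite mulrC ler_pdivrMr; last by lra.
have /truncn_itv/andP[_ ltk] : 0 <= eps^-1 by rewrite invr_ge0 ltW.
have k1 : 1 <= eps * (Num.truncn eps^-1).+1%:R.
  by rewrite -[leLHS](mulfV (lt0r_neq0 eps0)) ler_pM2l // ltW.
move: le_opt le_cuts; rewrite -!(ler_nat R) /block_size natrD !natrM.
set k := _.+1%:R in k1 *; have := mulr_ge0 (ler0n R M) (ler0n R cuts).
set x := (M%:R * cuts%:R) => x0 le_opt.
rewrite mulrAC -/x => le_cuts; nra.
Qed.

(** Rounding [eps^-1] up adds at most [1 <= eps_max / eps]. With [t = ln N / ln 2 >= 1] and at most
    [3 * t] levels, [k * (2 * num_levels + 2) + 2 <= k * (6 * t + 4) <= 10 * k * t]. *)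
Lemma probe_bound eps_max : 0 < eps -> eps <= eps_max -> 2 <= N ->
  (num_levels * (block_size + block_size) + 2 * (block_size + M))%:R
    <= 10 * (1 + eps_max) / ln 2 * (M%:R * ln N / eps).
Proof.
move=> eps0 le_eps N2; have l2 := ln2_gt0.
have lnN : 1 <= ln N / ln 2.
  by rewrite ler_pdivlMr // mul1r ler_ln ?posrE //; lra.
have /truncn_itv/andP[lek _] : 0 <= eps^-1 by rewrite invr_ge0 ltW.
have le_n := num_levels_le N2.
pose k : R := (Num.truncn eps^-1).+1%:R.
have k1 : 1 <= k by rewrite /k ler1n.
have lek2 : k <= (1 + eps_max) / eps.
  rewrite /k -natr1 mulrDl mul1r; apply: lerD => //.
  by rewrite ler_pdivlMr // mul1r.
rewrite [leRHS](_ : _ = M%:R * ((1 + eps_max) / eps * (10 * (ln N / ln 2))));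
  last by ring.
rewrite [leLHS](_ : _ = M%:R * (k * (2 * num_levels%:R + 2) + 2)); last first.
  by rewrite /block_size !(natrD, natrM) -/k; ring.
apply: ler_wpM2l; first exact: ler0n.
apply: (@le_trans _ _ (k * (10 * (ln N / ln 2)))); last first.
  by apply: ler_wpM2r => //; lra.
set t := ln N / ln 2 in lnN le_n *.
have := ler0n R num_levels; nra.
Qed.

End Bounds.

Theorem theorem5 (R : realType) (touch : bool) :
  exists alg : forall (eps N : R) (M : nat), lca R M,
    (forall (eps N : R) (M : nat) (J : {fset job R}) (O : oracle R),
       0 < eps -> 2 <= N -> valid_jobs N J -> successor_oracle touch J O ->
       exists sigma : schedule J M,
         [/\ feasible touch sigma,
             approximate touch eps sigma
           & consistent (alg eps N M) O sigma])
    /\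
    (forall eps_max : R, 0 < eps_max ->
       exists C : R, 0 < C /\
         forall (eps N : R) (M : nat) (J : {fset job R}) (O : oracle R)
                (I : job R),
           0 < eps -> eps <= eps_max -> 2 <= N -> valid_jobs N J ->
           successor_oracle touch J O -> I \in J ->
           (num_probes O (alg eps N M I))%:R <= C * (M%:R * ln N / eps)).
Proof.
pose alg (eps N : R) (M : nat) : lca R M :=
  if M is m.+1 then
    let K := block_size eps m.+1 in
    (* The window is open on the left when [touch] is false, so it starts
       before time 0. *)
    solve_probing touch m K (2 * (K + m.+1)) (num_levels N) (-1) (-1) N N
  else fun=> Answer _ None.
exists alg; split=> [eps N [|m] J O eps0 N2 validJ succO|eps_max eps_max0].
- exists [ffun=> None]; split.
  + by apply/forallP => i; apply/forallP => j; rewrite ffunE andbF.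
  + rewrite /approximate (_ : optimum _ _ _ = 0%N) ?mulr0 ?ler0n //.
    apply/eqP; rewrite -leqn0; apply/bigmax_leqP => sigma _.
    by rewrite leqn0; apply/eqP/eq_card0 => i; rewrite !inE; case: (sigma i) => // -[].
  + by move=> i; rewrite ffunE.
- have K0 : (0 < block_size eps m.+1)%N by [].
  have windowJ j : j \in J -> window touch (-1) N j.
    move=> /validJ[s0 _ le_fN]; rewrite /window le_fN andbT /starts_after.
    by apply: ltrW_lteif; lra.
  have empty x : (size (window_greedy touch m O (block_size eps m.+1) x x)
                    < block_size eps m.+1)%N.
    by rewrite (size_window_greedy_short m validJ succO).
  have N1 : -1 <= N by lra.
  have short : N - -1 < 2 ^+ num_levels N by rewrite opprK num_levels_gt.
  have [] := solveP validJ succO K0 (lexx (-1)) N1 (lexx N) short (empty _) (empty _).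
  set l := solve _ _ _ _ _ _ _ _ _ _ => sl _ ans [cuts [le_cuts _ opt]].
  exists (schedule_of_seq J l); split.
  + exact: feasible_schedule_of_seq.
  + apply: le_trans (_ : (size l)%:R <= _); last first.
      by rewrite ler_nat; exact: size_le_num_scheduled sl.
    apply: (approximation_ratio (M := m.+1) (cuts := cuts)) => //.
    apply/bigmax_leqP => sigma feas; rewrite -size_seq_of_schedule.
    have ss := schedules_seq_of_schedule feas.
    (* All jobs lie in the window from -1 to [N], so counting inside it counts the whole competing
       schedule. *)
    apply: leq_trans (opt _ ss); rewrite -(count_predT (seq_of_schedule _)).
    have [sJ _ _] := ss; apply: eq_leq; apply: eq_in_count => p /sJ /windowJ.
    by move=> /= ->.
  + by move=> i; rewrite /alg ans ?ffunE //; apply: windowJ; exact: valP.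
- exists (10 * (1 + eps_max) / ln 2); split.
    by rewrite divr_gt0 ?ln2_gt0 //; lra.
  move=> eps N [|m] J O I eps0 le_eps N2 _ _ _; first by rewrite !mul0r mulr0.
  apply: le_trans (probe_bound m.+1 eps0 le_eps N2); rewrite ler_nat.
  exact: num_probes_solve_probing.
Qed.
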